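(* Assume (A1)–(A5). If $\xi_m>0$, the minimum of the convergence rate of the MoLDD algorithm with stabilization parameter $L_\gamma=L_\gamma(\zeta)=\dfrac{L_\xi}{2(1-\zeta)}$ is reached for the optimal parameter $$\zeta^*=\underset{0<\zeta<1}{\operatorname{arg\,min}}\;\rho(\zeta)=1+\frac{L_\xi\xi_m-\sqrt{(L_\xi\xi_m)^2+4L_\xi\xi_m^2c_{\mathbf K,\gamma}+4L_\xi\xi_mc_{\mathbf K,\gamma}^2}}{4\xi_mc_{\mathbf K,\gamma}},$$ where $$\rho(\zeta)=\frac{L_\gamma(\zeta)-2\xi_m\zeta}{L_\gamma(\zeta)+2c_{\mathbf K,\gamma}}<1$$ is the convergence rate. Therefore, the optimal stabilization parameter is given by $$L_{\gamma,\mathrm{opt}}=\frac{L_\xi}{2(1-\zeta^* )}.$$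
   Context: Geometry: $\Omega\subset\mathbb R^d$, $d\in\{2,3\}$, is a bounded domain with Lipschitz boundary; $\gamma\subset\Omega$ is a $(d-1)$-dimensional non self-intersecting surface of class $C^2$ (the fracture) dividing $\Omega$ into two subdomains, $\Omega=\Omega_1\cup\Omega_2\cup\gamma$, $\gamma=\partial\Omega_1\cap\partial\Omega_2$, $\Gamma_i=\partial\Omega_i\cap\partial\Omega$; $\mathbf n_i$ is the outward unit normal to $\partial\Omega_i$; $\nabla_\tau$, $\nabla_\tau\cdot$ are the tangential gradient and divergence on $\gamma$. $(\cdot,\cdot)_D$, $\|\cdot\|_D$ are the $L^2(D)$ scalar product and norm. $T>0$ is the final time. Continuous problem: $\mathbf K_i^{-1}\mathbf u_i+\nabla p_i=0$, $\partial_tp_i+\nabla\cdot\mathbf u_i=f_i$ in $(0,T)\times\Omega_i$, $p_i=0$ on $\Gamma_i$, $p_i(\cdot,0)=p_i^0$; $\xi(\mathbf u_\gamma)+\mathbf K_\gamma^{-1}\mathbf u_\gamma+\nabla_\tau p_\gamma=0$, $\partial_tp_\gamma+\nabla_\tau\cdot\mathbf u_\gamma=f_\gamma+\mathbf u_1\cdot\mathbf n_1+\mathbf u_2\cdot\mathbf n_2$ in $(0,T)\times\gamma$, $p_\gamma=0$ on $\partial\gamma$, $p_\gamma(\cdot,0)=p^0_\gamma$; $-\mathbf u_i\cdot\mathbf n_i+\alpha_\gamma p_i=\alpha_\gamma p_\gamma$ on $(0,T)\times\gamma$. Assumptions. (A1) $\xi:\mathbb R\to\mathbb R$ is $C^1$,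 strictly increasing and Lipschitz: there are $\xi_m>0$ and $L_\xi$ with $\xi_m\le\xi'\le L_\xi<\infty$; otherwise, if $\xi$ is only increasing ($\xi'\ge0$), the flux of the continuous problem is assumed bounded, $\mathbf u\in[L^\infty(\Omega)]^d$, and $L_\xi:=\sup_{|\mathbf u|\le C_\xi}\xi'(\mathbf u)$ with $C_\xi:=\sup_{\mathbf x\in\overline\Omega}|\mathbf u(\mathbf x)|$ (and $\xi_m=0$). (A2) $\mathbf K$ ($\mathbf K|_{\Omega_i}=\mathbf K_i$) is constant in time, $\zeta^T\mathbf K^{-1}\zeta\ge c_{\mathbf K}|\zeta|^2$, $|\mathbf K^{-1}\zeta|\le C_{\mathbf K}|\zeta|$ a.e., $c_{\mathbf K}>0$. (A3) $\mathbf K_\gamma$ is constant in time, $\zeta^T\mathbf K_\gamma^{-1}\zeta\ge c_{\mathbf K,\gamma}|\zeta|^2$, $|\mathbf K_\gamma^{-1}\zeta|\le C_{\mathbf K,\gamma}|\zeta|$ a.e. on $\gamma$, $c_{\mathbf K,\gamma}>0$. (A4) $\alpha_\gamma>0$ is a constant. (A5) $p_i^0\in L^2(\Omega_i)$, $p_\gamma^0\in L^2(\gamma)$, $f_i\in L^2(0,T;L^2(\Omega_i))$, $f_\gamma\in L^2(0,T;L^2(\gamma))$, and $f,f_\gamma$ are piecewise constant in time on the temporal mesh, with values $f^n,f_\gamma^n$. $\xi(\mathbf u_\gamma)$ denotes $\xi$ applied to the tangential velocity (componentwise if $d=3$). Discretization: $\mathcal T_{h,i}$ is a partition of $\Omega_i$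 into simplices or rectangular elements such that $\mathcal T_h=\mathcal T_{h,1}\cup\mathcal T_{h,2}$ is a conforming mesh of $\Omega$; $\mathcal T_{h,\gamma}$ is a partition of $\gamma$ induced by $\mathcal T_h$ or slightly coarser; $h$ is the maximal mesh size. $M_{h,i}$, $M_{h,\gamma}$ are piecewise constants on $\mathcal T_{h,i}$, $\mathcal T_{h,\gamma}$; $\mathbf V_{h,i}$, $\mathbf V_{h,\gamma}\subset\mathbf H(\mathrm{div}_\tau,\gamma)$ are the lowest-order Raviart–Thomas–Nédélec spaces. With $\mathcal Q_{h,i}$ the $L^2$-projection onto $\mathbf V_{h,i}\cdot\mathbf n_i$, $\|\lambda\|_\gamma\lesssim\|\mathcal Q_{h,1}\lambda\|_\gamma+\|\mathcal Q_{h,2}\lambda\|_\gamma$ for all $\lambda\in M_{h,\gamma}$. The time step (possibly depending on $n$) is denoted $\tau>0$. Forms: $a_i(\mathbf u,\mathbf v)=(\mathbf K^{-1}\mathbf u,\mathbf v)_{\Omega_i}+\alpha_\gamma^{-1}(\mathbf u\cdot\mathbf n_i,\mathbf v\cdot\mathbf n_i)_\gamma$, $b_i(\mathbf u,q)=(\nabla\cdot\mathbf u,q)_{\Omega_i}$, $c_i(p,q)=(p,q)_{\Omega_i}$, $a_\gamma(\mathbf u,\mathbf v)=(\mathbf K_\gamma^{-1}\mathbf u,\mathbf v)_\gamma$, $b_\gamma(\mathbf u,\mu)=(\nabla_\tau\cdot\mathbf u,\mu)_\gamma$, $c_\gamma(\lambda,\mu)=(\lambda,\mu)_\gamma$. Interface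 operators: for $\lambda\in M_{h,\gamma}$, $(\mathbf u^*_{h,i}(\lambda),p^*_{h,i}(\lambda))\in\mathbf V_{h,i}\times M_{h,i}$ solves $a_i(\mathbf u^*_{h,i},\mathbf v)-b_i(\mathbf v,p^*_{h,i})=-(\lambda,\mathbf v\cdot\mathbf n_i)_\gamma$, $c_i(p^*_{h,i},q)+\tau b_i(\mathbf u^*_{h,i},q)=0$ for all $(\mathbf v,q)\in\mathbf V_{h,i}\times M_{h,i}$; $s_\gamma(\lambda,\mu)=-\sum_{i=1}^2(\mathbf u^*_{h,i}(\lambda)\cdot\mathbf n_i,\mu)_\gamma$ and $\|\mu\|_{s,\gamma}=s_\gamma(\mu,\mu)^{1/2}$. Further $(\bar{\mathbf u}^n_{h,i},\bar p^n_{h,i})\in\mathbf V_{h,i}\times M_{h,i}$ solves $a_i(\bar{\mathbf u}^n_{h,i},\mathbf v)-b_i(\mathbf v,\bar p^n_{h,i})=0$, $c_i(\bar p^n_{h,i}-p^{n-1}_{h,i},q)+\tau b_i(\bar{\mathbf u}^n_{h,i},q)=\tau(f^n,q)_{\Omega_i}$, where $p^{n}_{h,i}=p^*_{h,i}(\lambda^{n}_{h,\gamma})+\bar p^{n}_{h,i}$ for $n\ge1$ and $p^0_{h,i}$ is the given initial approximation; $(g^n_\gamma,\mu)_\gamma=\sum_{i=1}^2(\bar{\mathbf u}^n_{h,i}\cdot\mathbf n_i,\mu)_\gamma$. MoLDD algorithm (at time step $n\geq 1$, given $\lambda^{n-1}_{h,\gamma}$, stabilization $L_\gamma>0$): choose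 $\mathbf u^{n,-1}_{h,\gamma}\in\mathbf V_{h,\gamma}$; for $k=0,1,2,\dots$ find $(\mathbf u^{n,k}_{h,\gamma},\lambda^{n,k}_{h,\gamma})\in\mathbf V_{h,\gamma}\times M_{h,\gamma}$ such that for all $(\mathbf v,\mu)\in\mathbf V_{h,\gamma}\times M_{h,\gamma}$: $(\xi(\mathbf u^{n,k-1}_{h,\gamma})+L_\gamma(\mathbf u^{n,k}_{h,\gamma}-\mathbf u^{n,k-1}_{h,\gamma}),\mathbf v)_\gamma+a_\gamma(\mathbf u^{n,k}_{h,\gamma},\mathbf v)-b_\gamma(\mathbf v,\lambda^{n,k}_{h,\gamma})=0$ and $c_\gamma(\lambda^{n,k}_{h,\gamma}-\lambda^{n-1}_{h,\gamma},\mu)+\tau b_\gamma(\mathbf u^{n,k}_{h,\gamma},\mu)+\tau s_\gamma(\lambda^{n,k}_{h,\gamma},\mu)=\tau(f^n_\gamma+g^n_\gamma,\mu)_\gamma$. Convergence rate: with $\delta^k_{\mathbf u,h}=\mathbf u^{n,k}_{h,\gamma}-\mathbf u^{n,k-1}_{h,\gamma}$ and $\delta^k_{\lambda,h}=\lambda^{n,k}_{h,\gamma}-\lambda^{n,k-1}_{h,\gamma}$, ''the convergence rate'' is the factor $\rho(\zeta)$ in $\|\delta^k_{\mathbf u,h}\|_\gamma^2\le\rho(\zeta)\|\delta^{k-1}_{\mathbf u,h}\|_\gamma^2$ derived from the contraction estimate $\|\delta^k_{\lambda,h}\|_\gamma^2+\tau\|\delta^k_{\lambda,h}\|_{s,\gamma}^2+(\frac{L_\gamma}{2}+c_{\mathbf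 K,\gamma})\tau\|\delta^k_{\mathbf u,h}\|_\gamma^2\le(\frac{L_\gamma}{2}-\zeta\xi_m)\tau\|\delta^{k-1}_{\mathbf u,h}\|_\gamma^2$ valid for $L_\gamma=L_\xi/(2(1-\zeta))$, $\zeta\in[0,1)$.
   Formalization: The minimum over 0<ζ<1 is reached at ζ* exactly when c_{K,γ}(L_ξ−4ξ_m) < L_ξξ_m; otherwise ζ*≤0 and no minimum exists (e.g. ξ_m=1, L_ξ=8, c_{K,γ}=10). The formal theorem proves this equivalence and gives L_{γ,opt} under this condition. *)

(* Defs.v *)
From HB Require Import structures.
From mathcomp Require Import all_boot all_order all_algebra.
From mathcomp Require Import all_classical all_reals all_analysis.

Set Implicit Arguments.
Unset Strict Implicit.
Unset Printing Implicit Defensive.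

Import Order.TTheory GRing.Theory Num.Theory.
Import numFieldNormedType.Exports.

Local Open Scope classical_set_scope.
Local Open Scope ring_scope.

(* The fracture has dimension s, the ambient space is R^(s+1) = 'cV_s.+1;
   s = 1 or s = 2 in the theorem. *)

Section Euclid.
Context {R : realType}.

Definition dot m (u v : 'cV[R]_m) : R := \sum_(i < m) u i 0 * v i 0.

(* The library norm on matrices is the sup norm, hence this Euclidean norm. *)
Definition enorm m (u : 'cV[R]_m) : R := Num.sqrt (dot u u).

Definition is_argmin (A : set R) (f : R -> R) (x : R) : Prop :=
  A x /\ forall y, A y -> f x <= f y.

End Euclid.

Section Fields.
Context {R : realType} {s : nat}.
Local Notation E := 'cV[R]_s.+1.

Definition eball (x : E) (r : R) : set E := [set y | enorm (y - x) < r].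

Definition boundary (A : set E) : set E := closure A `\` interior A.

Definition C1 (f : E -> R) : Prop :=
  continuous f /\
  forall v : E, (forall x, derivable f x v) /\ continuous ('D_v f).

Definition C2 (f : E -> R) : Prop := C1 f /\ forall v : E, C1 ('D_v f).

Definition grad (f : E -> R) (x : E) : E :=
  \col_j 'D_(delta_mx j 0 : E) f x.

Definition test_function (Om : set E) (phi : E -> R) : Prop :=
  [/\ C1 phi, compact (closure [set x | phi x != 0])
    & closure [set x | phi x != 0] `<=` Om].

(* The graph lies over the hyperplane orthogonal to the unit vector e: only the
   values of g on that hyperplane matter. *)
Definition on_graph (e : E) (g : E -> R) : set E :=
  [set y | dot y e = g (y - dot y e *: e)].

Definition below_graph (e : E) (g : E -> R) : set E :=
  [set y | dot y e < g (y - dot y e *: e)].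

Definition lipschitz_boundary (A : set E) : Prop :=
  forall x, boundary A x -> exists r e g k,
    [/\ 0 < r, enorm e = 1, forall y z, `|g y - g z| <= k * enorm (y - z)
      & A `&` eball x r = below_graph e g `&` eball x r].

Definition C2_surface (A : set E) : Prop :=
  forall x, A x -> exists r e g,
    [/\ 0 < r, enorm e = 1, C2 g & A `&` eball x r = on_graph e g `&` eball x r].

Definition tangent (A : set E) (x w : E) : Prop :=
  exists c : R -> E,
    [/\ c 0 = x, \forall t \near (0 : R), A (c t)
      & is_derive (0 : R) (1 : R) c w].

Definition borel := g_sigma_algebraType (@open E).

Definition is_lebesgue (mu : {measure set borel -> \bar R}) : Prop :=
  forall a b : E, (forall i, a i 0 <= b i 0) ->
  mu [set x : E | forall i, a i 0 <= x i 0 <= b i 0]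
    = (\prod_i (b i 0 - a i 0))%:E.

(* s-dimensional Hausdorff outer measure; the constant is the volume of the
   s-dimensional ball of diameter 1, correct for s = 1 and s = 2 only. *)
Definition hausdorff_cst : R := if s == 1%N then 1 else pi / 4.

Definition hausdorff (A : set E) : \bar R :=
  ereal_sup [set z | exists2 del : R, 0 < del & z =
    ereal_inf [set y | exists (C : nat -> set E) (r : nat -> R),
      [/\ A `<=` \bigcup_k C k,
          forall k, 0 <= r k <= del,
          forall k x x', C k x -> C k x' -> enorm (x - x') <= r k
        & y = (\sum_(0 <= k <oo) (hausdorff_cst * r k ^+ s)%:E)%E]]].

Definition is_surface_measure (mu : {measure set borel -> \bar R}) : Prop :=
  forall A : set borel, measurable A -> mu A = hausdorff A.

Definition ip (mu : {measure set borel -> \bar R}) (D : set E) m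
    (u v : E -> 'cV[R]_m) : R :=
  \int[mu]_(x in (D : set borel)) dot (u x) (v x).

Definition ips (mu : {measure set borel -> \bar R}) (D : set E)
    (p q : E -> R) : R :=
  \int[mu]_(x in (D : set borel)) (p x * q x).

Definition norm2 (mu : {measure set borel -> \bar R}) (D : set E) m
  (u : E -> 'cV[R]_m) : R := Num.sqrt (ip mu D u u).

Definition norm2s (mu : {measure set borel -> \bar R}) (D : set E)
  (p : E -> R) : R := Num.sqrt (ips mu D p p).

Definition L2s (mu : {measure set borel -> \bar R}) (D : set E)
    (p : E -> R) : Prop :=
  measurable_fun (D : set borel) (p : borel -> R) /\
  mu.-integrable (D : set borel) (fun x => (p x ^+ 2)%:E).

Definition L2 (mu : {measure set borel -> \bar R}) (D : set E) m
    (u : E -> 'cV[R]_m) : Prop :=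
  forall i : 'I_m, L2s mu D (fun x => u x i 0).

End Fields.
Arguments borel R s : clear implicits.

Section Geometry.
Context {R : realType} {s : nat}.
Local Notation E := 'cV[R]_s.+1.

(* frame is an orthonormal tangent frame on the fracture: tangential fields are
   given by their s components in it, and xi acts on these components. *)
Record geometry := Geometry {
  Omega : set E;
  Om : 'I_2 -> set E;
  gam : set E;
  leb : {measure set (borel R s) -> \bar R};
  area : {measure set (borel R s) -> \bar R};
  frame : 'I_s -> E -> E }.

Record is_geometry (G : geometry) : Prop := IsGeometry {
  Omega_neq0 : Omega G !=set0;
  Omega_open : open (Omega G);
  Omega_connected : connected (Omega G);
  Omega_bounded : bounded_set (Omega G);
  Omega_lipschitz : lipschitz_boundary (Omega G);
  Om_neq0 : forall i, Om G i !=set0;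
  Om_open : forall i, open (Om G i);
  Om_connected : forall i, connected (Om G i);
  Om_disjoint : Om G 0 `&` Om G 1 = set0;
  Om_gam_disjoint : forall i, Om G i `&` gam G = set0;
  Omega_split : Omega G = Om G 0 `|` Om G 1 `|` gam G;
  gam_interface :
    gam G = boundary (Om G 0) `&` boundary (Om G 1) `&` Omega G;
  gam_C2 : C2_surface (gam G);
  leb_lebesgue : is_lebesgue (leb G);
  area_surface : is_surface_measure (area G);
  gam_finite_area : (area G (gam G : set (borel R s)) < +oo)%E;
  frame_measurable : forall j i, measurable_fun (gam G : set (borel R s))
    (fun x : borel R s => frame G j x i 0);
  frame_tangent : forall x j, gam G x -> tangent (gam G) x (frame G j x);
  frame_orthonormal : forall x j k, gam G x ->
    dot (frame G j x) (frame G k x) = (j == k)%:R }.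

Definition ambient (G : geometry) (u : E -> 'cV[R]_s) (x : E) : E :=
  \sum_j u x j 0 *: frame G j x.

(* A flux in Omega_i together with its divergence and its outward normal
   component on the fracture. *)
Record flux := Flux { fld : E -> E; dvg : E -> R; ntr : E -> R }.

(* Green's formula: dvg v is the weak divergence (take phi supported in
   Omega_i), ntr v the normal trace v . n_i on gam. *)
Definition Hdiv (G : geometry) (i : 'I_2) (v : flux) : Prop :=
  [/\ L2 (leb G) (Om G i) (fld v), L2s (leb G) (Om G i) (dvg v),
      L2s (area G) (gam G) (ntr v)
    & forall phi, test_function (Omega G) phi ->
        ip (leb G) (Om G i) (fld v) (grad phi)
          + ips (leb G) (Om G i) (dvg v) phi
        = ips (area G) (gam G) (ntr v) phi].

Record tflux := TFlux { tfld : E -> 'cV[R]_s; tdvg : E -> R }.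

(* As gam is relatively closed in Omega, the test functions are those that
   vanish near the boundary of gam. *)
Definition Hdivt (G : geometry) (v : tflux) : Prop :=
  [/\ L2 (area G) (gam G) (tfld v), L2s (area G) (gam G) (tdvg v)
    & forall phi, test_function (Omega G) phi ->
        ip (area G) (gam G) (ambient G (tfld v)) (grad phi)
          + ips (area G) (gam G) (tdvg v) phi = 0].

End Geometry.
Arguments geometry R s : clear implicits.
Arguments flux R s : clear implicits.
Arguments tflux R s : clear implicits.

Section Mesh.
Context {R : realType} {s : nat}.
Local Notation E := 'cV[R]_s.+1.

(* m-dimensional cells of R^(s+1): a simplex is given by its vertices, a
   rectangular cell by a corner and its edge vectors at that corner. *)
Inductive cell (m : nat) :=
  | Simplex of ('I_m.+1 -> E)
  | Brick of E & ('I_m -> E).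

Definition cell_wf m (C : cell m) : Prop :=
  match C with
  | Simplex p => forall t : 'I_m.+1 -> R,
      \sum_i t i = 0 -> \sum_i t i *: p i = 0 -> forall i, t i = 0
  | Brick o e => (forall j, e j != 0) /\
      (forall j k, j != k -> dot (e j) (e k) = 0)
  end.

Definition cell_pts m (C : cell m) : set E :=
  match C with
  | Simplex p => [set x | exists t : 'I_m.+1 -> R,
      [/\ forall i, 0 <= t i, \sum_i t i = 1 & x = \sum_i t i *: p i]]
  | Brick o e => [set x | exists t : 'I_m -> R,
      (forall j, 0 <= t j <= 1) /\ x = o + \sum_j t j *: e j]
  end.

(* Relative interior. *)
Definition cell_int m (C : cell m) : set E :=
  match C with
  | Simplex p => [set x | exists t : 'I_m.+1 -> R,
      [/\ forall i, 0 < t i, \sum_i t i = 1 & x = \sum_i t i *: p i]]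
  | Brick o e => [set x | exists t : 'I_m -> R,
      (forall j, 0 < t j < 1) /\ x = o + \sum_j t j *: e j]
  end.

(* Lowest-order Raviart-Thomas(-Nedelec) fields: a + b (x - p_0) on a simplex
   and, on a rectangular cell, the component along each edge direction is
   affine in the coordinate along that edge. *)
Definition RT0 (D : set E) m (C : cell m) (v : E -> E) : Prop :=
  match C with
  | Simplex p => exists (a : 'I_m.+1 -> R) (b : R),
      forall x, D x -> cell_int C x ->
      v x = \sum_i a i *: (p i - p ord0) + b *: (x - p ord0)
  | Brick o e => exists a b : 'I_m -> R,
      forall x, D x -> cell_int C x ->
      v x = \sum_j (a j + b j * (dot (x - o) (e j) / dot (e j) (e j))) *: e j
  end.

(* Face of a convex set, in the sense of convex geometry. *)
Definition is_face (F C : set E) : Prop :=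
  [/\ F !=set0, F `<=` C,
      forall x y (t : R), F x -> F y -> 0 < t < 1 -> F (t *: x + (1 - t) *: y)
    & forall x y (t : R), C x -> C y -> 0 < t < 1 ->
        F (t *: x + (1 - t) *: y) -> F x /\ F y].

Definition conforming m (T : set (cell m)) : Prop :=
  forall C C', T C -> T C' ->
  cell_pts C `&` cell_pts C' = set0 \/
  (is_face (cell_pts C `&` cell_pts C') (cell_pts C) /\
   is_face (cell_pts C `&` cell_pts C') (cell_pts C')).

Definition is_partition m (T : set (cell m)) (D : set E) : Prop :=
  [/\ finite_set T, forall C, T C -> cell_wf C,
      \bigcup_(C in T) cell_pts C = closure D
    & forall C C', T C -> T C' -> C <> C' ->
        cell_int C `&` cell_int C' = set0].

Record mesh := Mesh {
  Th : 'I_2 -> set (cell s.+1);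
  Tg : set (cell s) }.

Record is_mesh (G : geometry R s) (M : mesh) : Prop := IsMesh {
  Th_partition : forall i, is_partition (Th M i) (Om G i);
  Th_conforming : conforming (Th M 0 `|` Th M 1);
  Tg_partition : is_partition (Tg M) (gam G);
  Tg_conforming : conforming (Tg M);
  (* induced by Th or coarser *)
  Tg_induced : forall i C F, Th M i C -> is_face F (cell_pts C) ->
    F `<=` closure (gam G) -> exists2 C', Tg M C' & F `<=` cell_pts C' }.

Definition Vh (G : geometry R s) (M : mesh) (i : 'I_2) (v : flux R s) : Prop :=
  Hdiv G i v /\ forall C, Th M i C -> RT0 (Om G i) C (fld v).

Definition Vg (G : geometry R s) (M : mesh) (v : tflux R s) : Prop :=
  Hdivt G v /\ forall C, Tg M C -> RT0 (gam G) C (ambient G (tfld v)).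

Definition piecewise_cst (D : set E) m (T : set (cell m)) (p : E -> R) : Prop :=
  forall C, T C -> exists c, forall x, D x -> cell_int C x -> p x = c.

Definition Mh (G : geometry R s) (M : mesh) (i : 'I_2) (p : E -> R) : Prop :=
  L2s (leb G) (Om G i) p /\ piecewise_cst (Om G i) (Th M i) p.

Definition Mg (G : geometry R s) (M : mesh) (l : E -> R) : Prop :=
  L2s (area G) (gam G) l /\ piecewise_cst (gam G) (Tg M) l.

(* q is the L^2(gam)-projection of l onto the normal traces of Vh i. *)
Definition trace_projection (G : geometry R s) (M : mesh) (i : 'I_2)
    (l q : E -> R) : Prop :=
  (exists2 v, Vh G M i v & q = ntr v) /\
  forall v, Vh G M i v ->
    ips (area G) (gam G) (fun x => q x - l x) (ntr v) = 0.

Definition mortar_condition (G : geometry R s) (M : mesh) : Prop :=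
  exists2 c : R, 0 < c & forall (l : E -> R) (q : 'I_2 -> E -> R), Mg G M l ->
    (forall i, trace_projection G M i l (q i)) ->
    norm2s (area G) (gam G) l <= c * \sum_(i < 2) norm2s (area G) (gam G) (q i).

End Mesh.
Arguments mesh R s : clear implicits.

Section Model.
Context {R : realType} {s : nat}.
Local Notation E := 'cV[R]_s.+1.

Record coefs := Coefs {
  Kmx : E -> 'M[R]_s.+1;
  Kgmx : E -> 'M[R]_s;   (* components in the tangent frame *)
  alpha : R;
  xi : R -> R }.

(* The sources are piecewise constant in time: src m, srcg m are the values on the m-th
   time interval, of length dt m, 1 <= m <= Nt; pinit, pginit are the initial data. *)
Record time_data := TimeData {
  Tend : R;
  Nt : nat;
  dt : nat -> R;
  src : nat -> E -> R;
  srcg : nat -> E -> R;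
  pinit : E -> R;
  pginit : E -> R }.

Definition is_time_mesh (Q : time_data) : Prop :=
  [/\ 0 < Tend Q, forall m, (1 <= m <= Nt Q)%N -> 0 < dt Q m
    & \sum_(1 <= m < (Nt Q).+1) dt Q m = Tend Q].

(* The case xi_m > 0. *)
Definition A1 (P : coefs) (xim Lxi : R) : Prop :=
  [/\ forall x, derivable (xi P) x 1, continuous (derive1 (xi P)),
      {homo xi P : x y / x < y}, 0 < xim
    & forall x, xim <= derive1 (xi P) x <= Lxi].

Definition tensor_bounds (mu : {measure set (borel R s) -> \bar R})
    (D : set E) m (A : E -> 'M[R]_m) (c C : R) : Prop :=
  [/\ 0 < c,
      forall i j, measurable_fun (D : set (borel R s))
        (fun x : borel R s => invmx (A x) i j)
    & {ae mu, forall x, D x ->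
        A x \in unitmx /\ forall z : 'cV[R]_m,
          c * enorm z ^+ 2 <= dot z (invmx (A x) *m z) /\
          enorm (invmx (A x) *m z) <= C * enorm z}].

Definition A2 (G : geometry R s) (P : coefs) (c C : R) : Prop :=
  tensor_bounds (leb G) (Omega G) (Kmx P) c C.

Definition A3 (G : geometry R s) (P : coefs) (c C : R) : Prop :=
  tensor_bounds (area G) (gam G) (Kgmx P) c C.

Definition A4 (P : coefs) : Prop := 0 < alpha P.

Definition A5 (G : geometry R s) (Q : time_data) : Prop :=
  [/\ forall i, L2s (leb G) (Om G i) (pinit Q), L2s (area G) (gam G) (pginit Q),
      forall m i, (1 <= m <= Nt Q)%N -> L2s (leb G) (Om G i) (src Q m)
    & forall m, (1 <= m <= Nt Q)%N -> L2s (area G) (gam G) (srcg Q m)].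

Section Forms.
Variables (G : geometry R s) (P : coefs).

Definition a_i (i : 'I_2) (u v : flux R s) : R :=
  ip (leb G) (Om G i) (fun x => invmx (Kmx P x) *m fld u x) (fld v)
  + (alpha P)^-1 * ips (area G) (gam G) (ntr u) (ntr v).

Definition b_i (i : 'I_2) (u : flux R s) (q : E -> R) : R :=
  ips (leb G) (Om G i) (dvg u) q.

Definition c_i (i : 'I_2) (p q : E -> R) : R := ips (leb G) (Om G i) p q.

Definition a_g (u v : tflux R s) : R :=
  ip (area G) (gam G) (fun x => invmx (Kgmx P x) *m tfld u x) (tfld v).

Definition b_g (u : tflux R s) (mu : E -> R) : R :=
  ips (area G) (gam G) (tdvg u) mu.

Definition c_g (l mu : E -> R) : R := ips (area G) (gam G) l mu.

Variable M : mesh R s.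

(* (u, p) is the solution (u*_{h,i}(l), p*_{h,i}(l)) for the time step t. *)
Definition is_star (i : 'I_2) (t : R) (l : E -> R)
    (u : flux R s) (p : E -> R) : Prop :=
  [/\ Vh G M i u, Mh G M i p,
      forall v, Vh G M i v ->
        a_i i u v - b_i i v p = - ips (area G) (gam G) l (ntr v)
    & forall q, Mh G M i q -> c_i i p q + t * b_i i u q = 0].

Definition is_bar (i : 'I_2) (t : R) (fm pprev : E -> R)
    (u : flux R s) (p : E -> R) : Prop :=
  [/\ Vh G M i u, Mh G M i p,
      forall v, Vh G M i v -> a_i i u v - b_i i v p = 0
    & forall q, Mh G M i q ->
        c_i i (fun x => p x - pprev x) q + t * b_i i u q
        = t * ips (leb G) (Om G i) fm q].

End Forms.

Record star_op := StarOp {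
  ustar : nat -> 'I_2 -> (E -> R) -> flux R s;
  pstar : nat -> 'I_2 -> (E -> R) -> E -> R }.

Definition is_star_op (G : geometry R s) (P : coefs) (M : mesh R s) (Q : time_data)
    (S : star_op) : Prop :=
  forall m i l, (1 <= m <= Nt Q)%N -> Mg G M l ->
    is_star G P M i (dt Q m) l (ustar S m i l) (pstar S m i l).

Definition s_g (G : geometry R s) (S : star_op) (m : nat) (l mu : E -> R) : R :=
  - \sum_(i < 2) ips (area G) (gam G) (ntr (ustar S m i l)) mu.

Definition norm_s (G : geometry R s) (S : star_op) (m : nat) (mu : E -> R) : R :=
  Num.sqrt (s_g G S m mu mu).

(* What is known when the iteration of the n-th time step starts. *)
Record history := History {
  lam : nat -> E -> R;
  ph : 'I_2 -> nat -> E -> R;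
  ubar : 'I_2 -> nat -> flux R s;
  pbar : 'I_2 -> nat -> E -> R;
  gg : nat -> E -> R }.

Definition is_history (G : geometry R s) (P : coefs) (M : mesh R s) (Q : time_data)
    (S : star_op) (n : nat) (H : history) : Prop :=
  [/\ forall m, (m < n)%N -> Mg G M (lam H m),
      forall i, Mh G M i (ph H i 0),
      forall i m, (1 <= m <= n)%N ->
        is_bar G P M i (dt Q m) (src Q m) (ph H i m.-1) (ubar H i m) (pbar H i m),
      forall i m, (1 <= m < n)%N ->
        ph H i m = fun x => pstar S m i (lam H m) x + pbar H i m x
    & forall m, (1 <= m <= n)%N -> L2s (area G) (gam G) (gg H m) /\
        forall mu, Mg G M mu -> ips (area G) (gam G) (gg H m) mu
          = \sum_(i < 2) ips (area G) (gam G) (ntr (ubar H i m)) mu].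

(* MoLDD iteration at the time step n, stabilization parameter L. The index of
   the flux is shifted: u k is u^{n,k-1}, so u 0 is the initial guess u^{n,-1};
   la k is lambda^{n,k}. *)
Definition is_MoLDD (G : geometry R s) (P : coefs) (M : mesh R s) (Q : time_data)
    (S : star_op) (H : history) (n : nat) (L : R)
    (u : nat -> tflux R s) (la : nat -> E -> R) : Prop :=
  [/\ forall k, Vg G M (u k), forall k, Mg G M (la k),
      forall k v, Vg G M v ->
        ip (area G) (gam G)
          (fun x => map_mx (xi P) (tfld (u k) x)
                    + L *: (tfld (u k.+1) x - tfld (u k) x)) (tfld v)
        + a_g G P (u k.+1) v - b_g G v (la k) = 0
    & forall k mu, Mg G M mu ->
        c_g G (fun x => la k x - lam H n.-1 x) mu
        + dt Q n * b_g G (u k.+1) mu + dt Q n * s_g G S n (la k) mu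
        = dt Q n * ips (area G) (gam G) (fun x => srcg Q n x + gg H n x) mu].

(* delta_u^k = u^{n,k} - u^{n,k-1}, for k >= 0. *)
Definition delta_u (u : nat -> tflux R s) (k : nat) (x : E) : 'cV[R]_s :=
  tfld (u k.+1) x - tfld (u k) x.

(* delta_lambda^k, for k >= 1. *)
Definition delta_la (la : nat -> E -> R) (k : nat) (x : E) : R :=
  la k x - la k.-1 x.

End Model.
Arguments coefs R s : clear implicits.
Arguments time_data R s : clear implicits.
Arguments star_op R s : clear implicits.
Arguments history R s : clear implicits.

Section Rate.
Context {R : realType}.
Variables xim Lxi cKg : R.

Definition L_gamma (z : R) : R := Lxi / (2 * (1 - z)).

Definition rho (z : R) : R :=
  (L_gamma z - 2 * xim * z) / (L_gamma z + 2 * cKg).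

Definition zeta_star : R :=
  1 + (Lxi * xim - Num.sqrt ((Lxi * xim) ^+ 2 + 4 * Lxi * xim ^+ 2 * cKg
                             + 4 * Lxi * xim * cKg ^+ 2)) / (4 * xim * cKg).

(* L is the value of L_gamma at a minimizer of the rate over 0 < zeta < 1. *)
Definition optimal_stabilization (L : R) : Prop :=
  exists2 z, is_argmin `]0, 1[%classic rho z & L = L_gamma z.

End Rate.

(* Main.v *)
Require Import Defs.
From mathcomp Require Import all_boot all_order all_algebra.
From mathcomp Require Import all_classical all_reals all_analysis.
From mathcomp Require Import measurable_realfun ring lra.
Import Order.TTheory GRing.Theory Num.Theory.
Import numFieldNormedType.Exports.
Local Open Scope classical_set_scope.
Local Open Scope ring_scope.

(** Write [du_k], [dl_k] for the increments of the flux and of the pressure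
    between consecutive iterates, [L = Lxi / (2 (1 - zeta))] and [t] for the
    time step.

    Contraction. Subtracting two consecutive iterations and testing with the
    increments, the coupling terms [b_g] cancel and leave
      [|dl_k|^2 + t |dl_k|_s^2 + t a_g(du_k, du_k)
         + t (xi(u_(k)) - xi(u_(k-1)) + L du_k - L du_(k-1), du_k) = 0].
    By the mean value theorem the increment of [xi] is [e du_(k-1)] in each
    component, with a slope [xim <= e <= Lxi] depending on the point, so Young's
    inequality bounds [((L - e) du_(k-1), du_k)] by
    [((L - e)^2 du_(k-1)^2 + L^2 du_k^2) / (2 L)]. Since
    [Lxi = 2 L (1 - zeta)], one has [(L - e)^2 <= L^2 - 2 L zeta xim]
    ([young_slope]); with the coercivity of [a_g] this is the contraction
    estimate ([contraction]). Dropping the pressure terms and dividing by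
    [t (L / 2 + cKg)] gives the rate [rho zeta].

    The seminorm term requires the interface form [s_g], defined through chosen
    solutions of the subdomain problems, to be additive and nonnegative: the
    former is uniqueness for these problems as far as the normal trace is
    concerned ([star_traceB]), the latter the energy identity ([s_g_ge0]).
    Differences of discrete functions are never needed as test functions: the
    equations are linear in the test function on square-integrable fields, so
    testing with each iterate and subtracting has the same effect.

    Optimal rate. In [w = 1 - zeta] the rate is
    [(Lxi - 4 xim w (1 - w)) / (Lxi + 4 cKg w)]. Its divided difference between
    [w] and [v] is a positive multiple of a function [rate_slope w v] that
    increases in both arguments and vanishes at [w = v = 1 - zeta_star]. So the
    rate decreases and then increases around [zeta_star], which is its strict
    minimizer on [zeta < 1]; it lies in the open unit interval iff
    [0 < zeta_star], that is, iff [rate_slope 1 1 > 0]. *)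

Set Implicit Arguments.
Unset Strict Implicit.
Unset Printing Implicit Defensive.

(** * Square-integrable fields *)

Section SquareIntegrable.
Context {R : realType} {s : nat}.
Local Notation E := 'cV[R]_s.+1.
Context {mu : {measure set (borel R s) -> \bar R}} {D : set E}.
Hypothesis mD : measurable (D : set (borel R s)).

Lemma L2s_measurable (p : E -> R) : L2s mu D p ->
  measurable_fun (D : set (borel R s)) (p : borel R s -> R).
Proof. by case. Qed.

(** The domination is only required almost everywhere, as the bounds on the
    permeability tensors only hold there. *)
Lemma L2s_dominated (p g : E -> R) :
  measurable_fun (D : set (borel R s)) (p : borel R s -> R) ->
  mu.-integrable (D : set (borel R s)) (fun x => (g x)%:E) ->
  {ae mu, forall x, D x -> p x ^+ 2 <= g x} -> L2s mu D p.
Proof.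
move=> mp ig le_pg; split=> //.
have mp2 : measurable_fun (D : set (borel R s)) (fun x : borel R s => p x ^+ 2).
  exact: measurable_funX.
apply/integrableP; split; first exact/measurable_EFinP.
have /integrableP[mg] := ig; apply: le_lt_trans.
apply: ae_ge0_le_integral => //.
- by apply: measurableT_comp => //; exact/measurable_EFinP.
- exact: measurableT_comp.
apply: (filterS (F := almost_everywhere mu) _ le_pg) => x le_pgx Dx.
rewrite !abse_EFin lee_fin.
by rewrite ger0_norm ?sqr_ge0//; apply: (le_trans (le_pgx Dx)); exact: ler_norm.
Qed.

Lemma L2s_dominatedW (p g : E -> R) :
  measurable_fun (D : set (borel R s)) (p : borel R s -> R) ->
  mu.-integrable (D : set (borel R s)) (fun x => (g x)%:E) ->
  (forall x, D x -> p x ^+ 2 <= g x) -> L2s mu D p.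
Proof. by move=> mp ig le_pg; apply: (L2s_dominated mp ig); exact: aeW. Qed.

Lemma integrable_sqrD (a : R) (p q : E -> R) : L2s mu D p -> L2s mu D q ->
  mu.-integrable (D : set (borel R s)) (fun x => (a * (p x ^+ 2 + q x ^+ 2))%:E).
Proof.
move=> [_ ip] [_ iq].
apply: (eq_integrable mD (fun x => (a%:E * ((p x ^+ 2)%:E + (q x ^+ 2)%:E))%E)).
  by move=> x _; rewrite -EFinD -EFinM.
by apply: integrableZl => //; exact: integrableD.
Qed.

Lemma L2sD (p q : E -> R) : L2s mu D p -> L2s mu D q ->
  L2s mu D (fun x => p x + q x).
Proof.
move=> Lp Lq; apply: (L2s_dominatedW _ (integrable_sqrD 2 Lp Lq)).
  by apply: measurable_funD; exact: L2s_measurable.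
by move=> x _; have := sqr_ge0 (p x - q x); nra.
Qed.

Lemma L2s_cst0 : L2s mu D (fun=> 0).
Proof.
split; first exact: measurable_cst.
by apply: (eq_integrable mD (cst 0%E)); [move=> x _; rewrite expr0n|exact: integrable0].
Qed.

Lemma L2s_cst (a : R) : (mu (D : set (borel R s)) < +oo)%E ->
  L2s mu D (fun=> a).
Proof.
move=> Dfin; split; first exact: measurable_cst.
apply/integrableP; split; first exact/measurable_EFinP/measurable_cst.
by rewrite integral_cst//= lte_mul_pinfty.
Qed.

Lemma L2sZ (a : R) (p : E -> R) : L2s mu D p -> L2s mu D (fun x => a * p x).
Proof.
move=> Lp; apply: (L2s_dominatedW _ (integrable_sqrD (a ^+ 2) Lp L2s_cst0)).
  by apply: measurable_funM; [exact: measurable_cst|exact: L2s_measurable].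
by move=> x _; rewrite expr0n addr0 exprMn.
Qed.

Lemma L2sB (p q : E -> R) : L2s mu D p -> L2s mu D q ->
  L2s mu D (fun x => p x - q x).
Proof.
move=> Lp Lq; have := L2sD Lp (L2sZ (-1) Lq).
by congr L2s; apply/funext => x; rewrite mulN1r.
Qed.

Lemma integrable_mul (p q : E -> R) : L2s mu D p -> L2s mu D q ->
  mu.-integrable (D : set (borel R s)) (fun x => (p x * q x)%:E).
Proof.
move=> Lp Lq; apply: (le_integrable mD _ _ (integrable_sqrD 1 Lp Lq)).
  apply/measurable_EFinP; apply: measurable_funM; exact: L2s_measurable.
move=> x _; rewrite !abse_EFin lee_fin mul1r.
rewrite [leRHS]ger0_norm ?addr_ge0 ?sqr_ge0// ler_norml.
by apply/andP; split;
  have := sqr_ge0 (p x - q x); have := sqr_ge0 (p x + q x); nra.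
Qed.

Lemma ipsC (p q : E -> R) : ips mu D p q = ips mu D q p.
Proof. by apply: eq_Rintegral => x _; rewrite mulrC. Qed.

Lemma ipsDl (p q r : E -> R) : L2s mu D p -> L2s mu D q -> L2s mu D r ->
  ips mu D (fun x => p x + q x) r = ips mu D p r + ips mu D q r.
Proof.
move=> Lp Lq Lr.
rewrite /ips -RintegralD//; [|exact: integrable_mul..].
by apply: eq_Rintegral => x _; rewrite mulrDl.
Qed.

Lemma ipsZl (a : R) (p q : E -> R) : L2s mu D p -> L2s mu D q ->
  ips mu D (fun x => a * p x) q = a * ips mu D p q.
Proof.
move=> Lp Lq; rewrite /ips -RintegralZl//; last exact: integrable_mul.
by apply: eq_Rintegral => x _; rewrite mulrA.
Qed.

Lemma ipsBl (p q r : E -> R) : L2s mu D p -> L2s mu D q -> L2s mu D r ->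
  ips mu D (fun x => p x - q x) r = ips mu D p r - ips mu D q r.
Proof.
move=> Lp Lq Lr; rewrite -[- ips mu D q r]mulN1r -ipsZl// -ipsDl//; last exact: L2sZ.
by congr ips; apply/funext => x; rewrite mulN1r.
Qed.

Lemma ipsBr (p q r : E -> R) : L2s mu D p -> L2s mu D q -> L2s mu D r ->
  ips mu D p (fun x => q x - r x) = ips mu D p q - ips mu D p r.
Proof. by move=> *; rewrite ipsC ipsBl// ![ips _ _ _ p]ipsC. Qed.

Lemma ips_ge0 (p : E -> R) : 0 <= ips mu D p p.
Proof. by apply: Rintegral_ge0 => x _; rewrite -expr2 sqr_ge0. Qed.

(** As [ips p p = 0], the nonnegative function
    [a |-> ips (q - a p) (q - a p)] is affine, so its slope vanishes. *)
Lemma ips_null (p q : E -> R) : L2s mu D p -> L2s mu D q ->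
  ips mu D p p = 0 -> ips mu D p q = 0.
Proof.
move=> Lp Lq p0; apply/eqP; apply/negPn/negP => pq0.
set b := ips mu D p q in pq0; set c := ips mu D q q.
(* The affine function [c - 2 a b] takes the value [-1] at [a = t]. *)
pose t := (c + 1) / (2 * b).
have := ips_ge0 (fun x => q x - t * p x).
have Lt := L2sZ t Lp.
rewrite (ipsBl Lq Lt (L2sB Lq Lt)) !ipsBr// !ipsZl//.
rewrite !(ipsC _ (fun x => t * p x)) !ipsZl// p0 -/b -/c.
have -> : t * b = (c + 1) / 2 by rewrite /t; field.
lra.
Qed.

Lemma sqr_norm2s (p : E -> R) : norm2s mu D p ^+ 2 = ips mu D p p.
Proof. by rewrite sqr_sqrtr// ips_ge0. Qed.

(** The integrand coincides almost everywhere with its absolute value. *)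
Lemma Rintegral_ae_ge0 (f : E -> R) :
  measurable_fun (D : set (borel R s)) (f : borel R s -> R) ->
  {ae mu, forall x, D x -> 0 <= f x} ->
  0 <= \int[mu]_(x in (D : set (borel R s))) f x.
Proof.
move=> mf f0; rewrite /Rintegral; apply: fine_ge0.
rewrite (ae_eq_integral (fun x : borel R s => `|(f x)%:E|%E))//.
- by apply: integral_ge0 => x _; exact: abse_ge0.
- exact/measurable_EFinP.
- by apply: measurableT_comp => //; exact/measurable_EFinP.
- by apply: (filterS (F := almost_everywhere mu) _ f0) => x f0x Dx; rewrite abse_EFin ger0_norm// f0x.
Qed.

Section Vector.
Context {m : nat}.
Implicit Types u v w : E -> 'cV[R]_m.

Lemma L2D u v : L2 mu D u -> L2 mu D v -> L2 mu D (fun x => u x + v x).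
Proof.
move=> Lu Lv i; have := L2sD (Lu i) (Lv i).
by congr L2s; apply/funext => x; rewrite mxE.
Qed.

Lemma L2Z (a : R) u : L2 mu D u -> L2 mu D (fun x => a *: u x).
Proof.
move=> Lu i; have := L2sZ a (Lu i).
by congr L2s; apply/funext => x; rewrite mxE.
Qed.

Lemma L2B u v : L2 mu D u -> L2 mu D v -> L2 mu D (fun x => u x - v x).
Proof.
move=> Lu Lv i; have := L2sB (Lu i) (Lv i).
by congr L2s; apply/funext => x; rewrite !mxE.
Qed.

Lemma integrable_dot u v : L2 mu D u -> L2 mu D v ->
  mu.-integrable (D : set (borel R s)) (fun x => (dot (u x) (v x))%:E).
Proof.
move=> Lu Lv.
apply: (eq_integrable mD (fun x => \sum_(i < m) (u x i 0 * v x i 0)%:E)).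
  by move=> x _; rewrite sumEFin.
apply: integrable_sum => // i _; exact: integrable_mul.
Qed.

Lemma ip_sum u v : L2 mu D u -> L2 mu D v ->
  ip mu D u v = \sum_(i < m) ips mu D (fun x => u x i 0) (fun x => v x i 0).
Proof.
move=> Lu Lv; rewrite /ip /ips /Rintegral sum_fine; last first.
  by move=> i _; apply: integrable_fin_num => //; exact: integrable_mul.
rewrite -integral_sum//; last by move=> i; exact: integrable_mul.
by congr fine; apply: eq_integral => x _; rewrite sumEFin.
Qed.

Lemma ipC u v : ip mu D u v = ip mu D v u.
Proof.
by apply: eq_Rintegral => x _; apply: eq_bigr => i _; rewrite mulrC.
Qed.

Lemma ipDl u v w : L2 mu D u -> L2 mu D v -> L2 mu D w ->
  ip mu D (fun x => u x + v x) w = ip mu D u w + ip mu D v w.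
Proof.
move=> Lu Lv Lw; rewrite !ip_sum//; last exact: L2D.
rewrite -big_split; apply: eq_bigr => i _ /=; rewrite -ipsDl//.
by congr ips; apply/funext => x; rewrite mxE.
Qed.

Lemma ipZl (a : R) u v : L2 mu D u -> L2 mu D v ->
  ip mu D (fun x => a *: u x) v = a * ip mu D u v.
Proof.
move=> Lu Lv; rewrite !ip_sum//; last exact: L2Z.
rewrite mulr_sumr; apply: eq_bigr => i _ /=; rewrite -ipsZl//.
by congr ips; apply/funext => x; rewrite mxE.
Qed.

Lemma ipBl u v w : L2 mu D u -> L2 mu D v -> L2 mu D w ->
  ip mu D (fun x => u x - v x) w = ip mu D u w - ip mu D v w.
Proof.
move=> Lu Lv Lw; rewrite -[- ip mu D v w]mulN1r -ipZl// -ipDl//; last exact: L2Z.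
by congr ip; apply/funext => x; rewrite scaleN1r.
Qed.

Lemma ipBr u v w : L2 mu D u -> L2 mu D v -> L2 mu D w ->
  ip mu D u (fun x => v x - w x) = ip mu D u v - ip mu D u w.
Proof. by move=> *; rewrite ipC ipBl// ![ip _ _ _ u]ipC. Qed.

Lemma dot_ge0 (z : 'cV[R]_m) : 0 <= dot z z.
Proof. by apply: sumr_ge0 => i _; rewrite -expr2 sqr_ge0. Qed.

Lemma sqr_enorm (z : 'cV[R]_m) : enorm z ^+ 2 = dot z z.
Proof. by rewrite sqr_sqrtr// dot_ge0. Qed.

Lemma ip_ge0 u : 0 <= ip mu D u u.
Proof. by apply: Rintegral_ge0 => x _; exact: dot_ge0. Qed.

Lemma sqr_norm2 u : norm2 mu D u ^+ 2 = ip mu D u u.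
Proof. by rewrite sqr_sqrtr// ip_ge0. Qed.

Lemma measurable_dot u v : L2 mu D u -> L2 mu D v ->
  measurable_fun (D : set (borel R s)) (fun x : borel R s => dot (u x) (v x)).
Proof.
move=> Lu Lv; apply: measurable_sum => i.
by apply: measurable_funM; exact: L2s_measurable.
Qed.

Lemma ip_lower_bound (a b : R) u v w : L2 mu D u -> L2 mu D v -> L2 mu D w ->
  (forall x, D x -> a * dot (u x) (u x) - b * dot (v x) (v x) <= dot (w x) (u x)) ->
  a * ip mu D u u - b * ip mu D v v <= ip mu D w u.
Proof.
move=> Lu Lv Lw le_w.
have iu := integrable_dot (L2Z a Lu) Lu; have iv := integrable_dot (L2Z b Lv) Lv.
rewrite -!ipZl// /ip -RintegralB//; apply: le_Rintegral => //.
- apply: (eq_integrable mD (fun x => ((dot (a *: u x) (u x))%:E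
     - (dot (b *: v x) (v x))%:E)%E)); last exact: integrableB.
  by move=> x _; rewrite -EFinB.
- exact: integrable_dot.
move=> x Dx; apply: le_trans (le_w _ Dx).
rewrite /dot !mulr_sumr -!sumrB ler_sum// => i _.
by rewrite !mxE; lra.
Qed.

Section Tensor.
Context {A : E -> 'M[R]_m} {c C : R}.
Hypothesis hA : tensor_bounds mu D A c C.

Lemma L2_tensor u : L2 mu D u -> L2 mu D (fun x => invmx (A x) *m u x).
Proof.
move=> Lu i; case: hA => c0 mA bA.
have mg : mu.-integrable (D : set (borel R s))
    (fun x => (C ^+ 2 * dot (u x) (u x))%:E).
  apply: (eq_integrable mD (fun x => ((C ^+ 2)%:E * (dot (u x) (u x))%:E)%E)).
    by move=> x _; rewrite -EFinM.
  by apply: integrableZl => //; exact: integrable_dot.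
apply: (L2s_dominated _ mg).
  under eq_fun do rewrite mxE.
  apply: measurable_sum => j; apply: measurable_funM; first exact: mA.
  exact: L2s_measurable.
apply: (filterS (F := almost_everywhere mu) _ bA) => x bAx Dx.
have [_ /(_ (u x))[_ le_AC]] := bAx Dx.
set z := invmx (A x) *m u x in le_AC *.
have : z i 0 ^+ 2 <= dot z z.
  rewrite /dot (bigD1 i)//= -expr2 lerDl.
  by apply: sumr_ge0 => j _; rewrite -expr2 sqr_ge0.
move=> /le_trans; apply; rewrite -!sqr_enorm -exprMn.
by rewrite ler_sqr ?nnegrE// ?sqrtr_ge0// (le_trans _ le_AC)// sqrtr_ge0.
Qed.

Lemma tensor_coercive u : L2 mu D u ->
  c * ip mu D u u <= ip mu D (fun x => invmx (A x) *m u x) u.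
Proof.
move=> Lu; have LA := L2_tensor Lu; have Lc := L2Z c Lu.
rewrite -ipZl// -subr_ge0 -ipBl//.
apply: Rintegral_ae_ge0.
  by apply: measurable_dot => //; exact: L2B.
case: hA => c0 mA bA; apply: (filterS (F := almost_everywhere mu) _ bA) => x bAx Dx.
have [_ /(_ (u x))[le_cA _]] := bAx Dx.
rewrite sqr_enorm -subr_ge0 in le_cA; apply: (le_trans le_cA).
rewrite /dot mulr_sumr -sumrB ler_sum// => i _.
by rewrite !mxE; lra.
Qed.

End Tensor.
End Vector.
End SquareIntegrable.
(** * The interface operator *)

Section Interface.
Context {R : realType} {s : nat}.
Local Notation E := 'cV[R]_s.+1.

Lemma measurable_open (A : set E) : open A -> measurable (A : set (borel R s)).
Proof. exact: sub_sigma_algebra. Qed.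

Lemma measurable_boundary (A : set E) :
  measurable (boundary A : set (borel R s)).
Proof.
apply: measurableD; last by apply: measurable_open; exact: open_interior.
rewrite -[X in measurable X]setCK; apply: measurableC.
by apply: measurable_open; rewrite openC; exact: closed_closure.
Qed.

Lemma tensor_bounds_subset (mu : {measure set (borel R s) -> \bar R})
    (B D : set E) m (A : E -> 'M[R]_m) (c C : R) :
  measurable (B : set (borel R s)) -> measurable (D : set (borel R s)) ->
  D `<=` B -> tensor_bounds mu B A c C -> tensor_bounds mu D A c C.
Proof.
move=> mB mD DB [c0 mA bA]; split=> // [i j|].
  exact: (measurable_funS mB DB).
by apply: (filterS (F := almost_everywhere mu) _ bA) => x bAx /DB.
Qed.

Variables (G : geometry R s) (P : coefs R s) (M : mesh R s).
Hypothesis hG : is_geometry G.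

Lemma measurable_Om i : measurable (Om G i : set (borel R s)).
Proof. by apply: measurable_open; exact: Om_open. Qed.

Lemma measurable_gam : measurable (gam G : set (borel R s)).
Proof.
rewrite (gam_interface hG).
apply: measurableI; last by apply: measurable_open; exact: Omega_open.
by apply: measurableI; exact: measurable_boundary.
Qed.

Lemma Om_subset i : Om G i `<=` Omega G.
Proof.
rewrite (Omega_split hG) => x Omx; left.
have [i0|i1] : i = 0 \/ i = 1.
- by case: (unliftP ord0 i) => [j ->|->]; [right; rewrite (ord1 j); exact: val_inj|left].
- by left; rewrite -i0.
- by right; rewrite -i1.
Qed.

Local Notation mO := (measurable_Om _).
Local Notation mG := measurable_gam.

(** The integrability part of membership in [Vh]: the forms are bilinear on
    such fluxes, and differences stay in the class without any appeal to
    Green's formula or to the shape functions. *)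
Definition square_integrable_flux i (v : flux R s) : Prop :=
  [/\ L2 (leb G) (Om G i) (fld v), L2s (leb G) (Om G i) (dvg v)
    & L2s (area G) (gam G) (ntr v)].

Definition flux_sub (u v : flux R s) : flux R s :=
  Flux (fun x => fld u x - fld v x) (fun x => dvg u x - dvg v x)
       (fun x => ntr u x - ntr v x).

Lemma square_integrable_Vh i v : Vh G M i v -> square_integrable_flux i v.
Proof. by case=> -[]. Qed.

Lemma square_integrable_flux_sub i u v : square_integrable_flux i u ->
  square_integrable_flux i v -> square_integrable_flux i (flux_sub u v).
Proof.
move=> [u1 u2 u3] [v1 v2 v3]; split.
- exact: (L2B mO).
- exact: (L2sB mO).
- exact: (L2sB mG).
Qed.

Lemma MgB l l' : Mg G M l -> Mg G M l' -> Mg G M (fun x => l x - l' x).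
Proof.
move=> [Ll cl] [Ll' cl']; split; first exact: (L2sB mG).
move=> C TC; have [a la] := cl _ TC; have [b lb] := cl' _ TC.
by exists (a - b) => x Dx Cx; rewrite la// lb.
Qed.

Context {cK CK : R}.
Hypotheses (h2 : A2 G P cK CK) (h4 : A4 P).

Lemma Kmx_bounds i : tensor_bounds (leb G) (Om G i) (Kmx P) cK CK.
Proof.
apply: tensor_bounds_subset (measurable_open (Omega_open hG)) _ _ h2.
- exact: measurable_Om.
- exact: Om_subset.
Qed.

Lemma a_iBl i u v w : square_integrable_flux i u ->
  square_integrable_flux i v -> square_integrable_flux i w ->
  a_i G P i (flux_sub u v) w = a_i G P i u w - a_i G P i v w.
Proof.
move=> [u1 _ u3] [v1 _ v3] [w1 _ w3]; rewrite /a_i/= (ipsBl mG)//.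
under [X in ip _ _ X]eq_fun do rewrite mulmxBr.
by rewrite (ipBl mO) ?mulrBr//; [ring|exact: (L2_tensor mO (Kmx_bounds i))..].
Qed.

Lemma a_iBr i u v w : square_integrable_flux i u ->
  square_integrable_flux i v -> square_integrable_flux i w ->
  a_i G P i w (flux_sub u v) = a_i G P i w u - a_i G P i w v.
Proof.
move=> [u1 _ u3] [v1 _ v3] [w1 _ w3]; rewrite /a_i/= (ipsBr mG)//.
by rewrite (ipBr mO) ?mulrBr//; [ring|exact: (L2_tensor mO (Kmx_bounds i))].
Qed.

Lemma a_i_ge i u : square_integrable_flux i u ->
  (alpha P)^-1 * ips (area G) (gam G) (ntr u) (ntr u) <= a_i G P i u u.
Proof.
move=> [Lu _ _]; rewrite lerDr.
apply: le_trans (tensor_coercive mO (Kmx_bounds i) Lu).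
by have [cK0 _ _] := h2; rewrite mulr_ge0 ?ip_ge0// ltW.
Qed.

Lemma b_iBl i u v q : square_integrable_flux i u ->
  square_integrable_flux i v -> L2s (leb G) (Om G i) q ->
  b_i G i (flux_sub u v) q = b_i G i u q - b_i G i v q.
Proof. by move=> [_ ? _] [_ ? _] ?; exact: (ipsBl mO). Qed.

Lemma b_iBr i u p q : square_integrable_flux i u ->
  L2s (leb G) (Om G i) p -> L2s (leb G) (Om G i) q ->
  b_i G i u (fun x => p x - q x) = b_i G i u p - b_i G i u q.
Proof. by move=> [_ ? _] ? ?; exact: (ipsBr mO). Qed.

(** Discrete uniqueness: the defect [w] of additivity solves the homogeneous
    problem, and testing that with [w] itself leaves [a_i w w <= 0], which
    kills the normal trace of [w]. The test is legitimate because the equations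
    are linear in the test function and hold for the three terms of [w]. *)
Lemma star_traceB i t l1 l2 u1 u2 u3 p1 p2 p3 mu : 0 < t ->
  Mg G M l1 -> Mg G M l2 -> L2s (area G) (gam G) mu ->
  is_star G P M i t l1 u1 p1 -> is_star G P M i t l2 u2 p2 ->
  is_star G P M i t (fun x => l1 x - l2 x) u3 p3 ->
  ips (area G) (gam G) (ntr u3) mu
  = ips (area G) (gam G) (ntr u1) mu - ips (area G) (gam G) (ntr u2) mu.
Proof.
move=> t0 [Ll1 _] [Ll2 _] Lmu [V1 M1 e1 f1] [V2 M2 e2 f2] [V3 M3 e3 f3].
have [S1 S2 S3] := And3 (square_integrable_Vh V1) (square_integrable_Vh V2)
  (square_integrable_Vh V3).
have [[L1 _] [L2' _] [L3 _]] := And3 M1 M2 M3.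
pose w := flux_sub (flux_sub u1 u2) u3.
pose q := (fun x => (p1 x - p2 x) - p3 x).
have S12 := square_integrable_flux_sub S1 S2.
have Sw : square_integrable_flux i w by exact: square_integrable_flux_sub.
have L12 := L2sB mO L1 L2'.
have Lq : L2s (leb G) (Om G i) q by exact: (L2sB mO).
have ew v : Vh G M i v -> a_i G P i w v - b_i G i v q = 0.
  move=> Vv; have Sv := square_integrable_Vh Vv; have [_ _ Lv] := Sv.
  rewrite !a_iBl// !b_iBr//.
  by have := e3 _ Vv; rewrite (ipsBl mG)// -(opprK (ips _ _ l1 _)) -e1//
    -(opprK (ips _ _ l2 _)) -e2//; lra.
have fw r : Mh G M i r -> c_i G i q r + t * b_i G i w r = 0.
  move=> Mr; have [Lr _] := Mr; rewrite /c_i !(ipsBl mO)// !b_iBl//.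
  by have := f1 _ Mr; have := f2 _ Mr; have := f3 _ Mr; rewrite /c_i; lra.
have eww : a_i G P i w w = b_i G i w q.
  rewrite [a_i _ _ _ _ w]a_iBr// a_iBr// [b_i _ _ w _]b_iBl// b_iBl//.
  by have := ew _ V1; have := ew _ V2; have := ew _ V3; lra.
have fqq : c_i G i q q + t * b_i G i w q = 0.
  rewrite [c_i _ _ _ q](ipsBr mO)// (ipsBr mO)// b_iBr// b_iBr//.
  by have := fw _ M1; have := fw _ M2; have := fw _ M3; rewrite /c_i; lra.
have aw0 : a_i G P i w w <= 0.
  have q0 : 0 <= c_i G i q q by exact: ips_ge0.
  by rewrite eww -(pmulr_rle0 _ t0); lra.
have [_ _ Lw] := Sw.
have w0 : ips (area G) (gam G) (ntr w) (ntr w) = 0.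
  apply/le_anti; rewrite ips_ge0 andbT.
  by rewrite -(pmulr_rle0 _ (_ : 0 < (alpha P)^-1)) ?invr_gt0//
    (le_trans (a_i_ge Sw)).
have := ips_null mG Lw Lmu w0.
have [_ _ L1'] := S1; have [_ _ L2''] := S2; have [_ _ L3'] := S3.
by rewrite (ipsBl mG)// ?(ipsBl mG)//; [lra|exact: (L2sB mG)].
Qed.

Context {S : star_op R s} {Q : time_data R s} {n : nat}.
Hypothesis hS : is_star_op G P M Q S.
Hypotheses (hn : (1 <= n <= Nt Q)%N) (t0 : 0 < dt Q n).

Lemma s_gBl l1 l2 mu : Mg G M l1 -> Mg G M l2 -> L2s (area G) (gam G) mu ->
  s_g G S n (fun x => l1 x - l2 x) mu = s_g G S n l1 mu - s_g G S n l2 mu.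
Proof.
move=> M1 M2 Lmu; rewrite /s_g -opprD -sumrB; congr (- _).
apply: eq_bigr => i _.
by apply: (star_traceB t0 M1 M2 Lmu); apply: hS => //; exact: MgB.
Qed.

Lemma s_gBr l mu mu' : Mg G M l -> L2s (area G) (gam G) mu ->
  L2s (area G) (gam G) mu' ->
  s_g G S n l (fun x => mu x - mu' x) = s_g G S n l mu - s_g G S n l mu'.
Proof.
move=> Ml Lmu Lmu'; rewrite /s_g -opprD -sumrB; congr (- _).
apply: eq_bigr => i _; have [V _ _ _] := hS i hn Ml.
by have [_ _ Lu] := square_integrable_Vh V; rewrite (ipsBr mG).
Qed.

(** Energy identity: testing the problem of the interface operator with its
    own solution gives [s_g l l = \sum_i (a_i u u + c_i p p / dt)]. *)
Lemma s_g_ge0 l : Mg G M l -> 0 <= s_g G S n l l.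
Proof.
move=> Ml; rewrite /s_g -sumrN; apply: sumr_ge0 => i _.
have [V Mp e f] := hS i hn Ml; have := e _ V; have := f _ Mp.
set u := ustar _ _ _ _; set p := pstar _ _ _ _; rewrite ipsC => fp <-.
have Su := square_integrable_Vh V.
rewrite subr_ge0 (@le_trans _ _ 0)//.
  have p0 : 0 <= c_i G i p p by exact: ips_ge0.
  by rewrite -(pmulr_rle0 _ t0); lra.
by apply: le_trans (a_i_ge Su); rewrite mulr_ge0 ?ips_ge0// invr_ge0 ltW.
Qed.

Lemma sqr_norm_s l : Mg G M l -> norm_s G S n l ^+ 2 = s_g G S n l l.
Proof. by move=> Ml; rewrite sqr_sqrtr// s_g_ge0. Qed.

End Interface.
(** * Contraction of the iteration *)

Section Contraction.
Context {R : realType} {s : nat}.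
Local Notation E := 'cV[R]_s.+1.

Lemma xi_increment (P : coefs R s) (xim Lxi x y : R) : A1 P xim Lxi ->
  exists2 e, xim <= e <= Lxi & xi P x - xi P y = e * (x - y).
Proof.
move=> [dxi _ _ _ bxi].
wlog le_yx : x y / y <= x => [hw|].
  have [/hw//|/ltW/hw[e be de]] := leP y x.
  by exists e => //; rewrite -opprB de -mulrN opprB.
have der (z : R) : z \in `]y, x[ -> is_derive z (1 : R) (xi P) (derive1 (xi P) z).
  by move=> _; rewrite derive1E; exact: derivableP.
have [|c _ dc] := MVT_segment le_yx der.
  by apply: derivable_within_continuous => z _; exact: dxi.
by exists (derive1 (xi P) c).
Qed.

(** [xi] has at most linear growth, and the constant [xi 0] is square integrable
    because the fracture has finite area. *)
Lemma L2_xi (G : geometry R s) (P : coefs R s) (xim Lxi : R)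
  (u : E -> 'cV[R]_s) :
  is_geometry G -> A1 P xim Lxi -> L2 (area G) (gam G) u ->
  L2 (area G) (gam G) (fun x => map_mx (xi P) (u x)).
Proof.
move=> hG h1 Lu i; have mG := measurable_gam hG.
have L0 := L2s_cst mG (xi P 0) (gam_finite_area hG).
apply: (L2s_dominatedW mG _ (integrable_sqrD mG 2 L0 (L2sZ mG Lxi (Lu i)))).
  under eq_fun do rewrite mxE.
  apply: measurableT_comp; last exact: L2s_measurable (Lu i).
  apply: continuous_measurable_fun => x.
  by apply/differentiable_continuous/derivable1_diffP; case: h1.
move=> x _; rewrite mxE; set z := u x i 0.
have [e /andP[le_e e_le]] := xi_increment z 0 h1.
have [_ _ _ xim0 _] := h1.
rewrite subr0 => /(canRL (subrK _)) ->.
have := sqr_ge0 (e * z - xi P 0).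
have : (e * z) ^+ 2 <= (Lxi * z) ^+ 2.
  by rewrite !exprMn ler_wpM2r ?sqr_ge0// ler_sqr ?nnegrE//; lra.
nra.
Qed.

(** Young's inequality with weight [L], for one component: [e] is a difference
    quotient of [xi], [a] and [d] are the old and the new increment. The choice
    [X = 2 L (1 - z)] is what makes
    [(L - e) ^+ 2 <= L ^+ 2 - 2 * L * z * m] for all slopes [e] in [[m, X]]. *)
Lemma young_slope (L X m z e a d : R) : 0 < m -> m <= e <= X -> 0 < L ->
  X = 2 * L * (1 - z) -> 0 <= z ->
  L / 2 * d ^+ 2 - (L / 2 - z * m) * a ^+ 2 <= (e * a + L * d - L * a) * d.
Proof.
move=> m0 /andP[le_me le_eX] L0 eX z0; rewrite -subr_ge0 -(pmulr_rge0 _ L0).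
have e0 : 0 <= e * (X - e) by apply: mulr_ge0; lra.
have ze : 0 <= L * z * (e - m) by apply: mulr_ge0; [apply: mulr_ge0|]; lra.
have sa : 0 <= (e * (X - e) + 2 * (L * z * (e - m))) * a ^+ 2.
  by apply: mulr_ge0; [lra|exact: sqr_ge0].
have sd := sqr_ge0 (L * d - (L - e) * a).
rewrite eX in sa; lra.
Qed.

Lemma L_gamma_slope (X z : R) : z < 1 -> X = 2 * L_gamma X z * (1 - z).
Proof. by move=> z1; rewrite /L_gamma; field; lra. Qed.

Lemma L_gamma_gt0 (X z : R) : 0 < X -> z < 1 -> 0 < L_gamma X z.
Proof. by move=> X0 z1; rewrite divr_gt0// mulr_gt0// subr_gt0. Qed.

Variables (G : geometry R s) (P : coefs R s) (M : mesh R s).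
Hypothesis hG : is_geometry G.
Local Notation mG := (measurable_gam hG).
Local Notation ig := (ip (area G) (gam G)).

Context {xim Lxi cK CK cKg CKg : R}.
Hypotheses (h1 : A1 P xim Lxi) (h2 : A2 G P cK CK) (h3 : A3 G P cKg CKg)
  (h4 : A4 P).
Context {S : star_op R s} {Q : time_data R s} {n : nat} {H : history R s}.
Hypotheses (hS : is_star_op G P M Q S) (hn : (1 <= n <= Nt Q)%N)
  (t0 : 0 < dt Q n) (hlam : Mg G M (lam H n.-1)).

Context {L : R} {u : nat -> tflux R s} {la : nat -> E -> R}.
Hypothesis hu : is_MoLDD G P M Q S H n L u la.

Let flux_term k x : 'cV[R]_s :=
  map_mx (xi P) (tfld (u k) x) + L *: (tfld (u k.+1) x - tfld (u k) x).

Let L2u k : L2 (area G) (gam G) (tfld (u k)).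
Proof. by have [/(_ k)[[]]] := hu. Qed.

Let L2du k : L2 (area G) (gam G) (delta_u u k).
Proof. exact: (L2B mG). Qed.

Let L2dvg k : L2s (area G) (gam G) (tdvg (u k)).
Proof. by have [/(_ k)[[]]] := hu. Qed.

Let L2la k : L2s (area G) (gam G) (la k).
Proof. by have [_ /(_ k)[]] := hu. Qed.

Let L2_flux_term k : L2 (area G) (gam G) (flux_term k).
Proof. by apply: (L2D mG); [exact: L2_xi h1 _|exact/(L2Z mG)/(L2B mG)]. Qed.

Let ddvg k x := tdvg (u k.+2) x - tdvg (u k.+1) x.

(** Both increment identities below come from subtracting two consecutive
    iterations tested with each of the two iterates, then subtracting the
    results: the increment itself is never used as a test function. *)
Lemma flux_increment k :
  ig (fun x => flux_term k.+1 x - flux_term k x) (delta_u u k.+1)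
  + ig (fun x => invmx (Kgmx P x) *m delta_u u k.+1 x) (delta_u u k.+1)
  = ips (area G) (gam G) (ddvg k) (delta_la la k.+1).
Proof.
have [Vu _ e _] := hu; have LA j := L2_tensor mG h3 (@L2u j).
have LdA := L2B mG (LA k.+2) (LA k.+1).
have LdF := L2B mG (@L2_flux_term k.+1) (@L2_flux_term k).
under [in X in _ + X]eq_fun do rewrite mulmxBr.
rewrite !(ipBr mG)// !(ipBl mG)// (ipsBl mG)// ?(ipsBr mG)//; last exact: (L2sB mG).
have e' j v : Vg G M v -> ig (flux_term j) (tfld v)
    + ig (fun x => invmx (Kgmx P x) *m tfld (u j.+1) x) (tfld v)
    - ips (area G) (gam G) (tdvg v) (la j) = 0 by exact: e.
move: (e' k.+1 _ (Vu k.+2)) (e' k _ (Vu k.+2)) (e' k.+1 _ (Vu k.+1))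
  (e' k _ (Vu k.+1)).
(* What remains is a linear combination of real numbers. *)
do 8 move: (ig _ _) => ?; do 4 move: (ips _ _ _ _) => ?.
lra.
Qed.

Lemma pressure_increment k :
  ips (area G) (gam G) (delta_la la k.+1) (delta_la la k.+1)
  + dt Q n * ips (area G) (gam G) (ddvg k) (delta_la la k.+1)
  + dt Q n * s_g G S n (delta_la la k.+1) (delta_la la k.+1) = 0.
Proof.
have [_ Mla _ e] := hu; have [Llam _] := hlam.
have Ldla := L2sB mG (@L2la k.+1) (@L2la k).
have Lddvg := L2sB mG (@L2dvg k.+2) (@L2dvg k.+1).
rewrite (s_gBl hG h2 h4 hS hn t0)// !(s_gBr hG hS hn)//.
rewrite !(ipsBr mG)// !(ipsBl mG)//.
have := e k.+1 _ (Mla k.+1); have := e k _ (Mla k.+1).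
have := e k.+1 _ (Mla k); have := e k _ (Mla k).
rewrite /c_g /b_g !(ipsBl mG)//; lra.
Qed.

(** Eliminating the coupling term between the two increment identities leaves a
    balance of energies; Young's inequality and coercivity bound it from below. *)
Lemma contraction z k : 0 <= z < 1 -> L = L_gamma Lxi z ->
  norm2s (area G) (gam G) (delta_la la k.+1) ^+ 2
    + dt Q n * norm_s G S n (delta_la la k.+1) ^+ 2
    + (L / 2 + cKg) * dt Q n * norm2 (area G) (gam G) (delta_u u k.+1) ^+ 2
  <= (L / 2 - z * xim) * dt Q n * norm2 (area G) (gam G) (delta_u u k) ^+ 2.
Proof.
move=> /andP[z0 z1] eL; have [_ _ _ xim0 bxi] := h1.
have X0 : 0 < Lxi by have /andP[] := bxi 0; lra.
have L0 : 0 < L by rewrite eL L_gamma_gt0.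
have eX : Lxi = 2 * L * (1 - z) by rewrite eL; exact: L_gamma_slope.
have [_ Mla _ _] := hu.
rewrite (sqr_norm_s hG h2 h4 hS hn t0); last exact: (MgB hG).
rewrite sqr_norm2s !sqr_norm2.
have low : L / 2 * ig (delta_u u k.+1) (delta_u u k.+1)
    - (L / 2 - z * xim) * ig (delta_u u k) (delta_u u k)
    <= ig (fun x => flux_term k.+1 x - flux_term k x) (delta_u u k.+1).
  apply: (ip_lower_bound mG) => //; first exact: (L2B mG).
  move=> x _; rewrite /dot !mulr_sumr -sumrB ler_sum// => i _.
  rewrite /flux_term /delta_u !mxE.
  have [e be de] := xi_increment (tfld (u k.+1) x i 0) (tfld (u k) x i 0) h1.
  have := young_slope (tfld (u k.+1) x i 0 - tfld (u k) x i 0)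
    (tfld (u k.+2) x i 0 - tfld (u k.+1) x i 0) xim0 be L0 eX z0.
  rewrite -de; lra.
have coer := tensor_coercive mG h3 (@L2du k.+1).
have := flux_increment k; have := pressure_increment k.
set B := ips _ _ (ddvg k) _; set N := ips _ _ (delta_la _ _) _.
set V := ig (delta_u u k.+1) (delta_u u k.+1) in low coer *.
set W := ig (delta_u u k) (delta_u u k) in low *.
set I := ig _ _ in low *; set J := ig _ _ in coer *.
set s0 := s_g _ _ _ _ _.
move=> ep ef.
have : 0 <= dt Q n * (I - (L / 2 * V - (L / 2 - z * xim) * W) + (J - cKg * V)).
  by apply: mulr_ge0; [exact: ltW|lra].
rewrite -ef in ep; lra.
Qed.

End Contraction.
(** * Minimizing the rate *)

Section Rate.
Context {R : realType} {xim Lxi cKg : R}.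
Hypotheses (xim0 : 0 < xim) (Lxi0 : 0 < Lxi) (cKg0 : 0 < cKg).
Local Notation r := (rho xim Lxi cKg).
Local Notation zs := (zeta_star xim Lxi cKg).

Lemma rhoE (z : R) : z < 1 ->
  r z = (Lxi - 4 * xim * z * (1 - z)) / (Lxi + 4 * cKg * (1 - z)).
Proof.
move: xim0 Lxi0 cKg0 => x0 X0 c0.
move=> z1; have d0 : 0 < cKg * (1 - z) by rewrite mulr_gt0 ?subr_gt0.
by rewrite /rho /L_gamma; field; apply/andP; split; rewrite gt_eqF//; lra.
Qed.

Lemma rho_lt1 z : 0 <= z < 1 -> r z < 1.
Proof.
move: xim0 Lxi0 cKg0 => x0 X0 c0.
move=> /andP[z0 z1]; have d0 : 0 < cKg * (1 - z) by rewrite mulr_gt0 ?subr_gt0.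
have n0 : 0 <= xim * z * (1 - z).
  by rewrite mulr_ge0 ?mulr_ge0 ?subr_ge0// ltW.
by rewrite rhoE// ltr_pdivrMr; lra.
Qed.

(** The divided difference, up to a positive factor, of the rate seen as a
    function of [w = 1 - z]; on the diagonal it is the numerator of the
    derivative. *)
Definition rate_slope (w v : R) : R :=
  xim * Lxi * (w + v) + 4 * xim * cKg * w * v - Lxi * (xim + cKg).

Lemma rate_slopeC w v : rate_slope w v = rate_slope v w.
Proof. by rewrite /rate_slope; ring. Qed.

Lemma rhoB z y : z < 1 -> y < 1 ->
  exists2 K, 0 < K & r z - r y = K * ((y - z) * rate_slope (1 - z) (1 - y)).
Proof.
move: xim0 Lxi0 cKg0 => x0 X0 c0.
move=> z1 y1.
have dz : 0 < cKg * (1 - z) by rewrite mulr_gt0 ?subr_gt0.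
have dy : 0 < cKg * (1 - y) by rewrite mulr_gt0 ?subr_gt0.
exists (4 / ((Lxi + 4 * cKg * (1 - z)) * (Lxi + 4 * cKg * (1 - y)))).
  by rewrite divr_gt0// mulr_gt0//; lra.
by rewrite !rhoE// /rate_slope; field; apply/andP; split; rewrite gt_eqF//; lra.
Qed.

(** The formula for [zs] is the quadratic formula for [rate_slope w w = 0], with
    the root in [w > 0] selected. *)
Lemma zeta_star_root : zs < 1 /\ rate_slope (1 - zs) (1 - zs) = 0.
Proof.
move: xim0 Lxi0 cKg0 => x0 X0 c0.
rewrite /rate_slope /zeta_star; set D := _ + _ + _; set q := Num.sqrt D.
have p1 : 0 < Lxi * xim by apply: mulr_gt0.
have p2 : 0 < xim * cKg by apply: mulr_gt0.
have p3 : 0 < Lxi * xim ^+ 2 * cKg by rewrite !mulr_gt0// exprn_gt0.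
have p4 : 0 < Lxi * xim * cKg ^+ 2 by rewrite !mulr_gt0// exprn_gt0.
have ltD : (Lxi * xim) ^+ 2 < D by rewrite /D; lra.
have D0 : 0 <= D by apply: le_trans (ltW ltD); exact: sqr_ge0.
have q2 : q ^+ 2 = D by rewrite sqr_sqrtr.
have ltq : Lxi * xim < q.
  by rewrite -(ltr_sqr (ltW p1) (sqrtr_ge0 _)) q2.
split.
  by rewrite gtrDl pmulr_llt0 ?invr_gt0 ?subr_lt0//; lra.
transitivity ((q ^+ 2 - D) / (4 * xim * cKg)); last by rewrite q2 subrr mul0r.
by rewrite /D; field; rewrite !gt_eqF.
Qed.

Lemma rate_slope_lt w v w' v' : 0 < w -> 0 < v -> w <= w' -> v < v' ->
  rate_slope w v < rate_slope w' v'.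
Proof.
move: xim0 Lxi0 cKg0 => x0 X0 c0.
move=> w0 v0 ww vv; rewrite /rate_slope.
have p1 : 0 < xim * Lxi by apply: mulr_gt0.
have p2 : 0 < xim * cKg by apply: mulr_gt0.
have : xim * Lxi * (w + v) < xim * Lxi * (w' + v') by rewrite ltr_pM2l//; lra.
have : xim * cKg * (w * v) <= xim * cKg * (w' * v').
  by rewrite ler_pM2l// ler_pM// ltW.
lra.
Qed.

(** The slope at [(w, 1 - zs)] vanishes for [w = 1 - zs] and increases with
    [w], so the rate strictly exceeds [r zs] on both sides: [zs] is the strict
    global minimizer over [z < 1]. *)
Lemma rho_zeta_star_lt z : z < 1 -> z != zs -> r zs < r z.
Proof.
move: xim0 Lxi0 cKg0 => x0 X0 c0.
move=> z1 zzs; have [zs1 root] := zeta_star_root.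
have [K K0 eK] := rhoB z1 zs1; rewrite -subr_gt0 eK pmulr_rgt0// rate_slopeC.
move: zzs; rewrite neq_lt => /orP[lt|lt].
- have := @rate_slope_lt (1 - zs) (1 - zs) (1 - zs) (1 - z).
  rewrite root => sl; apply: mulr_gt0; first by rewrite subr_gt0.
  by apply: sl; lra.
- have := @rate_slope_lt (1 - zs) (1 - z) (1 - zs) (1 - zs).
  rewrite root => sl; have neg : zs - z < 0 by lra.
  rewrite nmulr_rgt0//.
  by apply: sl; lra.
Qed.

Lemma rho_increasing y z : zs <= y -> y < z -> z < 1 -> r y < r z.
Proof.
move: xim0 Lxi0 cKg0 => x0 X0 c0.
move=> zsy yz z1; have [zs1 root] := zeta_star_root.
have y1 : y < 1 by lra.
have [K K0 eK] := rhoB z1 y1; rewrite -subr_gt0 eK pmulr_rgt0// rate_slopeC.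
have neg : y - z < 0 by lra.
rewrite nmulr_rgt0// -root.
by apply: rate_slope_lt; lra.
Qed.

(** When [zs <= 0] the rate increases on the open interval [0 < z < 1], which
    therefore contains no minimizer. *)
Lemma argmin_zeta_star z : is_argmin `]0, 1[%classic r z -> z = zs.
Proof.
move: xim0 Lxi0 cKg0 => x0 X0 c0.
move=> [/=]; rewrite in_itv/= => /andP[z0 z1] zmin.
have [zs0|zs0] := ltP 0 zs.
  apply/eqP/negPn/negP => /(rho_zeta_star_lt z1); rewrite ltNge => /negP; apply.
  by apply: zmin; rewrite /= in_itv/= zs0; have [] := zeta_star_root.
have : r (z / 2) < r z by apply: rho_increasing; lra.
by rewrite ltNge zmin//= in_itv/=; apply/andP; split; lra.
Qed.

Lemma zeta_star_gt0 : (0 < zs) = (cKg * (Lxi - 4 * xim) < Lxi * xim).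
Proof.
move: xim0 Lxi0 cKg0 => x0 X0 c0.
have [zs1 root] := zeta_star_root.
have slope1 : (cKg * (Lxi - 4 * xim) < Lxi * xim) = (0 < rate_slope 1 1).
  by rewrite /rate_slope; apply/idP/idP; lra.
rewrite slope1; apply/idP/idP => [zs0|].
  by rewrite -[ltLHS]root; apply: rate_slope_lt; lra.
apply: contraTT; rewrite -!leNgt le_eqVlt => /orP[/eqP zs0|zs0].
  by move: root; rewrite zs0 subr0 => ->.
by rewrite -[leRHS]root; apply/ltW/rate_slope_lt; lra.
Qed.

Lemma argmin_zeta_star_iff :
  is_argmin `]0, 1[%classic r zs <-> cKg * (Lxi - 4 * xim) < Lxi * xim.
Proof.
move: xim0 Lxi0 cKg0 => x0 X0 c0.
rewrite -zeta_star_gt0; split=> [[/=]|zs0].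
  by rewrite in_itv/= => /andP[].
have [zs1 _] := zeta_star_root.
split=> [|y /=]; first by rewrite /= in_itv/= zs0.
rewrite in_itv/= => /andP[_ y1].
by have [->//|/(rho_zeta_star_lt y1)/ltW] := eqVneq y zs.
Qed.

End Rate.
Theorem corollary5p11 (R : realType) (s : nat) (hs : s.+1 = 2%N \/ s.+1 = 3%N)
  (G : geometry R s) (hG : is_geometry G)
  (M : mesh R s) (hM : is_mesh G M) (hmortar : mortar_condition G M)
  (P : coefs R s) (Q : time_data R s) (hQ : is_time_mesh Q)
  (xim Lxi cK CK cKg CKg : R)
  (h1 : A1 P xim Lxi) (h2 : A2 G P cK CK) (h3 : A3 G P cKg CKg)
  (h4 : A4 P) (h5 : A5 G Q)
  (S : star_op R s) (hS : is_star_op G P M Q S)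
  (n : nat) (hn : (1 <= n <= Nt Q)%N)
  (H : history R s) (hH : is_history G P M Q S n H) :
  [/\
    (* rho is the convergence rate of MoLDD with parameter L_gamma zeta *)
    forall (zeta : R) (u : nat -> tflux R s) (la : nat -> 'cV[R]_s.+1 -> R),
      0 <= zeta < 1 ->
      is_MoLDD G P M Q S H n (L_gamma Lxi zeta) u la ->
      forall k, (1 <= k)%N ->
        norm2s (area G) (gam G) (delta_la la k) ^+ 2
          + dt Q n * norm_s G S n (delta_la la k) ^+ 2
          + (L_gamma Lxi zeta / 2 + cKg) * dt Q n
              * norm2 (area G) (gam G) (delta_u u k) ^+ 2
        <= (L_gamma Lxi zeta / 2 - zeta * xim) * dt Q n
              * norm2 (area G) (gam G) (delta_u u k.-1) ^+ 2
        /\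
        norm2 (area G) (gam G) (delta_u u k) ^+ 2
        <= rho xim Lxi cKg zeta
             * norm2 (area G) (gam G) (delta_u u k.-1) ^+ 2,
    forall zeta : R, 0 <= zeta < 1 -> rho xim Lxi cKg zeta < 1,
    (* zeta_star is the only possible minimizer over 0 < zeta < 1, and it is
       one exactly under the stated condition on the constants *)
    forall zeta : R, is_argmin `]0, 1[%classic (rho xim Lxi cKg) zeta ->
      zeta = zeta_star xim Lxi cKg,
    is_argmin `]0, 1[%classic (rho xim Lxi cKg) (zeta_star xim Lxi cKg)
      <-> cKg * (Lxi - 4 * xim) < Lxi * xim
  & forall L : R, cKg * (Lxi - 4 * xim) < Lxi * xim ->
      optimal_stabilization xim Lxi cKg L
      <-> L = Lxi / (2 * (1 - zeta_star xim Lxi cKg))].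
Proof.
have [_ _ _ xim0 bxi] := h1; have [cKg0 _ _] := h3.
have Lxi0 : 0 < Lxi by have /andP[] := bxi 0; lra.
have t0 : 0 < dt Q n by have [_ dt0 _] := hQ; exact: dt0.
have hlam : Mg G M (lam H n.-1).
  by have [Mlam _ _ _ _] := hH; apply: Mlam; rewrite ltn_predL; case/andP: hn.
have [zs1 _] := zeta_star_root xim0 Lxi0 cKg0.
split.
- move=> z u la zP hu [//|k] _ /=.
  have est := contraction hG h1 h2 h3 h4 hS hn t0 hlam hu k zP erefl.
  split=> //; have /andP[z0 z1] := zP; have L0 := L_gamma_gt0 Lxi0 z1.
  have Ldla0 := sqr_ge0 (norm2s (area G) (gam G) (delta_la la k.+1)).
  have Ls0 := mulr_ge0 (ltW t0) (sqr_ge0 (norm_s G S n (delta_la la k.+1))).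
  rewrite /rho mulrAC ler_pdivlMr; last by lra.
  rewrite -(ler_pM2l t0).
  move: est Ldla0 Ls0; set a := norm2s _ _ _ ^+ 2; set b := norm_s _ _ _ _ ^+ 2.
  set c := norm2 _ _ _ ^+ 2; set d := norm2 _ _ _ ^+ 2.
  lra.
- by move=> z; exact: rho_lt1.
- by move=> z; exact: argmin_zeta_star.
- exact: argmin_zeta_star_iff.
- move=> L cond; split=> [[z /(argmin_zeta_star xim0 Lxi0 cKg0) -> ->]//|->].
  by exists (zeta_star xim Lxi cKg) => //; exact/argmin_zeta_star_iff.
Qed.
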